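(* For a rigid body obstacle with DMSP dynamics: (a) If $\mathcal{O}(\overline{0})$ is bounded, then $\mathrm{PrOccupySet}_S(\alpha;\tau)$ is bounded for every $\alpha>0$ and $\tau\in\{1,\dots,N\}$. (b) If $\mathcal{O}(\overline{0})$ is closed, then for every $\tau\in\{1,\dots,N\}$ the function $\overline{y}\mapsto\phi_{\boldsymbol{s}}(\overline{y};\tau)$ is upper semicontinuous on $\mathbb{R}^n$, and $\mathrm{PrOccupySet}_S(\alpha;\tau)$ is closed for every $\alpha\ge0$. (c) If $\mathcal{O}(\overline{0})$ is compact, then $\mathrm{PrOccupySet}_S(\alpha;\tau)$ is compact for every $\alpha>0$ and $\tau\in\{1,\dots,N\}$.
   Context: DMSP system (discrete-time Markovian switched system with affine parameter-varying stochastic subsystems). Let $N\ge1$, let $\mathcal{Q}\subset\mathbb{R}$ and $\mathcal{P}\subset\mathbb{R}^l$ be finite, and let $A:\mathcal{P}\to\mathbb{R}^{n\times n}$, $B:\mathcal{P}\to\mathbb{R}^{n\times m}$, $F:\mathcal{P}\to\mathbb{R}^{n\times p}$. For $t=0,\dots,N-1$: (i) the discrete state $\boldsymbol{\sigma}_t\in\mathcal{Q}$ is a (possibly time-inhomogeneous) Markov chain with $\boldsymbol{\sigma}_0=q_0$; (ii) $\boldsymbol{\lambda}_{t+1}=l_\lambda(\boldsymbol{\sigma}_{t+1},t,\boldsymbol{\lambda}_t)\in\mathcal{P}$, $\boldsymbol{\lambda}_0=\overline{\lambda}_0$, for a given Borel function $l_\lambda:\mathcal{Q}\times\{0,\dots,N-1\}\times\mathcal{P}\to\mathcal{P}$;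 (iii) $\boldsymbol{x}_{t+1}=A(\boldsymbol{\lambda}_t)\boldsymbol{x}_t+B(\boldsymbol{\lambda}_t)\overline{u}_t+F(\boldsymbol{\lambda}_t)\boldsymbol{w}_t\in\mathbb{R}^n$, $\boldsymbol{x}_0=\overline{x}_0$. The $q_0,\overline\lambda_0,\overline{x}_0$ and inputs $\overline{u}_t\in\mathbb{R}^m$ are known and deterministic; $\boldsymbol{w}_0,\dots,\boldsymbol{w}_{N-1}$ are IID random vectors in $\mathbb{R}^p$ with a density, independent of the discrete state process. Obstacle: $h_{\mathrm{obs}}:\mathbb{R}^n\to\mathbb{R}$ is Borel and $\mathcal{O}(\overline{c})=\{\overline{z}\in\mathbb{R}^n:h_{\mathrm{obs}}(\overline{z}-\overline{c})\ge0\}$; $\mathcal{O}(\overline{0})$ is a Borel set of non-zero Lebesgue measure. $-\mathcal{G}=\{\overline z:-\overline z\in\mathcal{G}\}$. With $\boldsymbol{s}_\tau=(\boldsymbol{\sigma}_\tau,\boldsymbol{x}_\tau)$, the probabilistic occupancy function is $\phi_{\boldsymbol{s}}(\overline{y};\tau)=\mathbb{P}\{\boldsymbol{s}_\tau\in\bigcup_{q\in\mathcal{Q}}\{q\}\times(-\mathcal{O}(-\overline{y}))\}$, and the $\alpha$-probabilistic occupied set is $\mathrm{PrOccupySet}_S(\alpha;\tau)=\{\overline{y}\in\mathbb{R}^n:\phi_{\boldsymbol{s}}(\overline{y};\tau)\ge\alpha\}$. *)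

(* Defs.v *)
From HB Require Import structures.
From mathcomp Require Import all_boot all_order all_algebra.
From mathcomp Require Import all_classical all_reals all_analysis.
From mathcomp Require Import measurable_realfun.

Set Implicit Arguments.
Unset Strict Implicit.
Unset Printing Implicit Defensive.

Import Order.TTheory GRing.Theory Num.Theory.
Import numFieldNormedType.Exports.

Local Open Scope classical_set_scope.
Local Open Scope ring_scope.

(* R^n with its Borel sigma-algebra; as a type, convertible to 'cV[R]_n. *)
Definition borelV (R : realType) (n : nat) :=
  g_sigma_algebraType (@open 'cV[R]_n).
HB.instance Definition _ R n := Measurable.on (@borelV R n).

Lemma measurable_coordsV d (T : measurableType d) (R : realType) k
    (f : T -> borelV R k) :
  (forall i : 'I_k, measurable_fun setT (fun t => (f t : 'cV[R]_k) i 0)) ->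
  measurable_fun setT f.
Proof.
move=> mf; apply: (@measurability _ _ _ (borelV R k) setT f (@open 'cV[R]_k)) => //.
move=> _ [U oU <-].
rewrite setTI.
pose box (z : 'cV[rat]_k * nat) : set T := [set t |
  forall i : 'I_k, `|ratr (z.1 i 0) - (f t : 'cV[R]_k) i 0| < z.2.+1%:R^-1].
pose inU (z : 'cV[rat]_k * nat) := forall v : 'cV[R]_k,
  (forall i : 'I_k, `|ratr (z.1 i 0) - v i 0| < z.2.+1%:R^-1) -> U v.
have -> : f @^-1` U = \bigcup_z (if pselect (inU z) then box z else set0).
  apply/seteqP; split => [t /= Uft|t [z _]]; last first.
    by case: pselect => // zU zt; exact: (zU _ zt).
  have /nbhs_ballP[e /= e0 eU] : nbhs (f t : 'cV[R]_k) U.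
    exact: open_nbhs_nbhs.
  have [m me] : exists m : nat, m.+1%:R^-1 < e / 2.
    have e20 : 0 < e / 2 by rewrite divr_gt0.
    have [m _ mP] := near_infty_natSinv_lt (PosNum e20).
    by exists m; exact: (mP m (leqnn m)).
  have /choice[q qf] (i : 'I_k) : exists q : rat,
      `|ratr q - (f t : 'cV[R]_k) i 0| < m.+1%:R^-1.
    have lt : (f t : 'cV[R]_k) i 0 < (f t : 'cV[R]_k) i 0 + m.+1%:R^-1.
      by rewrite ltrDl invr_gt0.
    have [q] := rat_in_itvoo lt; rewrite in_itv/= => /andP[q1 q2].
    by exists q; rewrite ger0_norm ?subr_ge0 1?ltW// ltrBlDl.
  exists (\col_i q i, m) => //; case: pselect => [_ i|[]] /=.
    by rewrite mxE.
  move=> v /= vq; apply: eU; split => // i j; rewrite (ord1 j).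
  rewrite /ball/= -[X in `|X|](subrKA (ratr (q i))).
  rewrite (le_lt_trans (ler_normD _ _))// [ltRHS]splitr ltrD//.
    by rewrite distrC (lt_trans (qf i)).
  by have := vq i; rewrite mxE => /lt_trans; exact.
apply: countable_bigcupT_measurable => [|z]; first exact: countableP.
case: pselect => //= ?.
have -> : box z = \bigcap_(i in [set: 'I_k])
    (fun t => (f t : 'cV[R]_k) i 0) @^-1` ball (ratr (z.1 i 0) : R) z.2.+1%:R^-1.
  by apply/seteqP; split => [t zt i _|t zt i]; [exact: zt|exact: (zt i I)].
apply: fin_bigcap_measurable => // i _.
rewrite -[X in measurable X]setTI; apply: mf => //.
exact: (open_measurable (ball_open _ _)).
Qed.

Lemma measurable_coordV (R : realType) k (i : 'I_k) :
  measurable_fun [set: borelV R k] (fun v : 'cV[R]_k => v i 0).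
Proof.
apply: (measurability _ (RGenOpens.measurableE R)) => _ [_ [a [b ->] <-]].
rewrite setTI; apply: sub_sigma_algebra.
by apply: open_comp; [move=> v _; exact: coord_continuous|exact: interval_open].
Qed.

Lemma sigma_finite_product d1 d2 (T1 : measurableType d1)
    (T2 : measurableType d2) (R : realType)
    (m1 : {sigma_finite_measure set T1 -> \bar R})
    (m2 : {sigma_finite_measure set T2 -> \bar R}) :
  sigma_finite setT (m1 \x m2)%E.
Proof.
have /sigma_finiteP[F [TF ndF Foo]] := sigma_finiteT m1.
have /sigma_finiteP[G [TG ndG Goo]] := sigma_finiteT m2.
exists (fun n => F n `*` G n) => [|k].
  rewrite -setXTT TF TG predeqE => -[x y]; split; last first.
    by move=> [n _ []/= ? ?]; split; exists n.
  move=> [/= [n _ Fnx] [k _ Gky]]; exists (maxn n k) => //; split.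
  - by move: x Fnx; exact/subsetPset/ndF/leq_maxl.
  - by move: y Gky; exact/subsetPset/ndG/leq_maxr.
have [? ?] := Foo k; have [? ?] := Goo k.
split; first exact: measurableX.
by rewrite product_measure1E// lte_mul_pinfty// ge0_fin_numE.
Qed.

Section lebesgue_measureV.
Context {R : realType}.

Definition consV n (z : R * borelV R n) : borelV R n.+1 :=
  col_mx (z.1)%:M (z.2 : 'cV[R]_n) : 'cV[R]_(1 + n).

Definition unconsV n (v : borelV R n.+1) : R * borelV R n :=
  ((v : 'cV[R]_(1 + n)) 0 0, dsubmx (v : 'cV[R]_(1 + n))).

Lemma consVK n : cancel (@consV n) (@unconsV n).
Proof.
case=> a v; congr pair; last by rewrite /consV col_mxKd.
have -> : (0 : 'I_(1 + n)) = lshift n 0 by apply/val_inj.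
by rewrite /consV col_mxEu mxE.
Qed.

Lemma measurable_consV n : measurable_fun setT (@consV n).
Proof.
apply: measurable_coordsV => i.
have [[j ->]|[j ->]] : (exists j : 'I_1, i = lshift n j) \/
    (exists j : 'I_n, i = rshift 1 j).
- by case: (@split_ordP 1 n i) => j ->; [left|right]; exists j.
- apply: (eq_measurable_fun fst) => [z _|]; last exact: measurable_fst.
  rewrite (ord1 j); apply/esym/(etrans (col_mxEu (z.1)%:M (z.2 : 'cV_n) 0 0)).
  by rewrite mxE.
- apply: (eq_measurable_fun (fun z : R * borelV R n => (z.2 : 'cV[R]_n) j 0)) => [z _|].
    by apply/esym; exact: (col_mxEd (z.1)%:M (z.2 : 'cV_n) j 0).
  exact: (measurableT_comp (measurable_coordV j) measurable_snd).
Qed.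

Lemma measurable_unconsV n : measurable_fun setT (@unconsV n).
Proof.
apply: measurable_fun_pair; first exact: (@measurable_coordV R n.+1).
apply: measurable_coordsV => i; under eq_fun do rewrite /= mxE.
exact: (@measurable_coordV R n.+1).
Qed.

Section step.
Context {n : nat}.
Variable m : {sigma_finite_measure set (borelV R n) -> \bar R}.

Definition lebesgue_measureS : set (borelV R n.+1) -> \bar R :=
  pushforward (@lebesgue_measure R \x m)%E (@consV n).

Let lebesgueS0 : lebesgue_measureS set0 = 0%E.
Proof. by rewrite /lebesgue_measureS /pushforward preimage_set0 measure0. Qed.

Let lebesgueS_ge0 A : (0 <= lebesgue_measureS A)%E.
Proof. by rewrite /lebesgue_measureS /pushforward measure_ge0. Qed.

Let lebesgueS_sigma_additive : semi_sigma_additive lebesgue_measureS.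
Proof.
move=> F mF tF mUF; rewrite /lebesgue_measureS /pushforward preimage_bigcup.
apply: measure_semi_sigma_additive.
- by move=> k; rewrite -[X in measurable X]setTI; exact: measurable_consV.
- apply/trivIsetP => /= i j _ _ ij; rewrite -preimage_setI.
  by move/trivIsetP : tF => /(_ _ _ _ _ ij) ->//; rewrite preimage_set0.
- by rewrite -preimage_bigcup -[X in measurable X]setTI; exact: measurable_consV.
Qed.

HB.instance Definition _ := isMeasure.Build _ _ _ lebesgue_measureS
  lebesgueS0 lebesgueS_ge0 lebesgueS_sigma_additive.

Let lebesgueS_sigma_finite : sigma_finite setT lebesgue_measureS.
Proof.
have [F TF mF] := sigma_finite_product (@lebesgue_measure R) m.
exists (fun k => @unconsV n @^-1` F k) => [|k].
  by rewrite -preimage_bigcup -TF preimage_setT.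
have [mFk Fk] := mF k; split.
  by rewrite -[X in measurable X]setTI; exact: measurable_unconsV.
rewrite /lebesgue_measureS /pushforward.
have -> // : @consV n @^-1` (@unconsV n @^-1` F k) = F k.
by apply/seteqP; split => z /=; rewrite consVK.
Qed.

HB.instance Definition _ := Measure_isSigmaFinite.Build _ _ _ lebesgue_measureS
  lebesgueS_sigma_finite.

End step.

(* Lebesgue measure on R^n, the image of the iterated product of the
   one-dimensional Lebesgue measure; see lebesgue_measureV_box. *)
Fixpoint lebesgue_measureV (n : nat) :
    {sigma_finite_measure set (borelV R n) -> \bar R} :=
  if n is k.+1 then lebesgue_measureS (lebesgue_measureV k)
  else @dirac _ (borelV R 0) (0 : 'cV[R]_0) R.

Lemma lebesgue_measureV_box n (a b : 'I_n -> R) : (forall i, a i <= b i) ->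
  lebesgue_measureV n [set v : 'cV[R]_n | forall i, a i <= v i 0 <= b i] =
  (\prod_i (b i - a i))%:E.
Proof.
elim: n => [|n ih] in a b * => ab.
  by rewrite big_ord0 /= /dirac indicE mem_set// => -[].
rewrite big_ord_recl /=.
rewrite /lebesgue_measureS /pushforward.
have cons0 y (v : borelV R n) : (consV (y, v) : 'cV[R]_n.+1) ord0 0 = y.
  have -> : (ord0 : 'I_n.+1) = lshift n (0 : 'I_1) by apply/val_inj.
  by apply: (etrans (col_mxEu y%:M (v : 'cV_n) 0 0)); rewrite mxE.
have consS y (v : borelV R n) i :
    (consV (y, v) : 'cV[R]_n.+1) (lift ord0 i) 0 = (v : 'cV_n) i 0.
  have -> : lift ord0 i = rshift 1 i by apply/val_inj.
  exact: (col_mxEd y%:M (v : 'cV_n) i 0).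
have -> : @consV n @^-1` [set v : 'cV[R]_n.+1 | forall i, a i <= v i 0 <= b i] =
  `[a ord0, b ord0] `*` [set v : 'cV[R]_n |
     forall i, a (lift ord0 i) <= v i 0 <= b (lift ord0 i)].
  apply/seteqP; split => [[y v] /= H|[y v] /= [y0 H] i].
    split=> [|i]; first by have := H ord0; rewrite in_itv/= cons0.
    by have := H (lift ord0 i); rewrite consS.
  have [j ->|->] := unliftP ord0 i; first by rewrite consS.
  by rewrite cons0; move: y0; rewrite in_itv.
rewrite product_measure1E//=; last first.
  rewrite (_ : [set _ | _] = \bigcap_(i in [set: 'I_n]) ((fun v : borelV R n =>
      (v : 'cV[R]_n) i 0) @^-1` `[a (lift ord0 i), b (lift ord0 i)])).
    apply: fin_bigcap_measurable => // i _.
    by rewrite -[X in measurable X]setTI; apply: measurable_coordV.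
  apply/seteqP; split => v /= H i.
    by move=> _; rewrite /= in_itv; exact: H.
  by have := H i I; rewrite /= in_itv.
rewrite (ih (fun i => a (lift ord0 i)) (fun i => b (lift ord0 i)))//.
rewrite lebesgue_measure_itv/= lte_fin EFinM; congr (_ * _)%E.
case: ltP => // ba; have -> : a ord0 = b ord0 by apply/le_anti; rewrite ab ba.
by rewrite subrr.
Qed.

End lebesgue_measureV.

Section probability.
Context d (Omega : measurableType d) (R : realType) (Pr : probability Omega R).
Local Open Scope ereal_scope.

Definition mutually_independent d' (T : measurableType d') (I : finType)
    (X : I -> Omega -> T) : Prop :=
  forall (J : {set I}) (B : I -> set T), (forall i, measurable (B i)) ->
    Pr (\bigcap_(i in [set` J]) (X i @^-1` B i)) =
    \prod_(i in J) Pr (X i @^-1` B i).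

Definition identically_distributed d' (T : measurableType d') (I : Type)
    (X : I -> Omega -> T) : Prop :=
  forall (i j : I) (B : set T), measurable B ->
    Pr (X i @^-1` B) = Pr (X j @^-1` B).

Definition independent_families (F G : set (set Omega)) : Prop :=
  forall A B, F A -> G B -> Pr (A `&` B) = Pr A * Pr B.

Definition has_density k (X : Omega -> borelV R k) : Prop :=
  exists f : borelV R k -> R, [/\ measurable_fun setT f, forall z, (0 <= f z)%R &
    forall B, measurable B ->
      Pr (X @^-1` B) = \int[lebesgue_measureV k]_(z in B) (f z)%:E].

Definition cond_prob (A B : set Omega) : R :=
  (fine (Pr (A `&` B)) / fine (Pr B))%R.

(* The transition probabilities may depend on t. *)
Definition markov_chain (N : nat) (sigma : nat -> Omega -> R) : Prop :=
  forall (t : nat) (s : nat -> R) (q : R), (t < N)%N ->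
    let past := [set om | forall i, (i <= t)%N -> sigma i om = s i] in
    Pr past != 0 ->
    cond_prob (sigma t.+1 @^-1` [set q]) past =
    cond_prob (sigma t.+1 @^-1` [set q]) (sigma t @^-1` [set s t]).

End probability.

(* The processes are indexed by nat, but constrained only for t <= N (mode,
   param, cstate) and t < N (noise, input). The functions matA, matB, matF and
   lfun are total, but only their values on modes and params matter. *)
Record dmsp d (Omega : measurableType d) (R : realType)
    (Pr : probability Omega R) (N n m p l : nat) := DMSP {
  modes : set R;
  finite_modes : finite_set modes;
  params : set (borelV R l);
  finite_params : finite_set params;
  matA : 'cV[R]_l -> 'M[R]_n;
  matB : 'cV[R]_l -> 'M[R]_(n, m);
  matF : 'cV[R]_l -> 'M[R]_(n, p);
  lfun : R -> nat -> 'cV[R]_l -> 'cV[R]_l;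
  lfun_params : forall q t lam, modes q -> (t < N)%N -> params lam ->
    params (lfun q t lam);
  measurable_lfun : measurable_fun
    ((modes `*` [set t | (t < N)%N]) `*` params)
    (fun z : R * nat * borelV R l => lfun z.1.1 z.1.2 z.2 : borelV R l);
  mode0 : R;
  mode0_modes : modes mode0;
  param0 : 'cV[R]_l;
  param0_params : params param0;
  cstate0 : 'cV[R]_n;
  input : nat -> 'cV[R]_m;
  mode : nat -> Omega -> R;
  measurable_mode : forall t, (t <= N)%N -> measurable_fun setT (mode t);
  mode_modes : forall t om, (t <= N)%N -> modes (mode t om);
  mode_init : forall om, mode 0 om = mode0;
  mode_markov : markov_chain Pr N mode;
  param : nat -> Omega -> 'cV[R]_l;
  param_init : forall om, param 0 om = param0;
  param_step : forall t om, (t < N)%N ->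
    param t.+1 om = lfun (mode t.+1 om) t (param t om);
  noise : nat -> Omega -> 'cV[R]_p;
  measurable_noise : forall t, (t < N)%N ->
    measurable_fun setT (noise t : Omega -> borelV R p);
  noise_independent :
    mutually_independent Pr (fun t : 'I_N => noise t : Omega -> borelV R p);
  noise_identically_distributed :
    identically_distributed Pr (fun t : 'I_N => noise t : Omega -> borelV R p);
  noise_density : forall t, (t < N)%N -> has_density Pr (noise t);
  noise_mode_independent : independent_families Pr
    (g_sigma_preimage (fun t : 'I_N => noise t : Omega -> borelV R p))
    (g_sigma_preimage (fun t : 'I_N.+1 => mode t));
  cstate : nat -> Omega -> 'cV[R]_n;
  cstate_init : forall om, cstate 0 om = cstate0;
  cstate_step : forall t om, (t < N)%N ->
    cstate t.+1 om = matA (param t om) *m cstate t om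
      + matB (param t om) *m input t + matF (param t om) *m noise t om
}.

Definition obstacle (R : realType) n (hobs : 'cV[R]_n -> R) (c : 'cV[R]_n)
  : set 'cV[R]_n := [set z | 0 <= hobs (z - c)].

Definition opp_set (V : zmodType) (G : set V) : set V := [set z | G (- z)].

Definition upper_semicontinuous (X : topologicalType) (R : numFieldType)
    (f : X -> \bar R) : Prop :=
  forall x a, (f x < a%:E)%E ->
    exists2 V, nbhs x V & forall y, V y -> (f y < a%:E)%E.

Section occupancy.
Context d (Omega : measurableType d) (R : realType) (Pr : probability Omega R).
Context (N n m p l : nat) (S : dmsp Pr N n m p l) (hobs : 'cV[R]_n -> R).

Definition state (tau : nat) (om : Omega) : R * 'cV[R]_n :=
  (mode S tau om, cstate S tau om).

Definition occupancy (tau : nat) (y : 'cV[R]_n) : \bar R :=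
  Pr (state tau @^-1`
    \bigcup_(q in modes S) ([set q] `*` opp_set (obstacle hobs (- y)))).

Definition PrOccupySet (alpha : R) (tau : nat) : set 'cV[R]_n :=
  [set y | (alpha%:E <= occupancy tau y)%E].

End occupancy.

(* Main.v *)
(** The occupancy function is [y |-> P(y - x_tau \in O(0))], because the mode
    always lies in [modes S]. If [O(0)] lies in a ball of radius [M], this is at
    most the tail [P(|x_tau| > |y| - M)]. If [O(0)] is closed, it is the
    intersection of its open [1/(k+1)]-thickenings [O_k]; by continuity from
    above, [P(y - x_tau \in O(0)) < a] forces [P(y - x_tau \in O_k) < a] for some
    [k], and then [P(y' - x_tau \in O(0)) < a] for all [y'] within [1/(k+1)] of
    [y]. *)
Require Import Defs.
From mathcomp Require Import all_boot all_order all_algebra.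
From mathcomp Require Import all_classical all_reals all_analysis.
From mathcomp Require Import measurable_realfun.

Set Implicit Arguments.
Unset Strict Implicit.
Unset Printing Implicit Defensive.

Import Order.TTheory GRing.Theory Num.Theory.
Import numFieldNormedType.Exports.

Local Open Scope classical_set_scope.
Local Open Scope ring_scope.

(** * Heine-Borel for column vectors *)

Lemma trmx_continuous (K : numFieldType) m n :
  continuous (@trmx K m n : 'M[K]_(m, n) -> 'M[K]_(n, m)).
Proof.
move=> x U /nbhs_ballP[e /= e0 eU]; apply/nbhs_ballP; exists e => //= y [_ xy].
by apply: eU; split=> // i j; rewrite !mxE.
Qed.

(** The norm is a maximum over the entries, and transposition only swaps their two indices. *)
Lemma mx_norm_trmx (K : realDomainType) m n (x : 'M[K]_(m, n)) :
  `|x^T| = `|x|.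
Proof.
rewrite /Num.norm/= !mx_normrE.
rewrite (reindex (fun ij : 'I_m * 'I_n => (ij.2, ij.1)))/=; last first.
  by exists (fun ij => (ij.2, ij.1)) => -[].
by apply: eq_bigr => ij _; rewrite mxE.
Qed.

(** Heine-Borel is carried over from row vectors: transposition is continuous and preserves the
    norm, so the transposed set is again bounded and closed, and [A] is the continuous image of a
    compact set. *)
Lemma bounded_closed_compact_cV (R : realType) n (A : set 'cV[R]_n) :
  bounded_set A -> closed A -> compact A.
Proof.
move=> [M [Mreal AM]] cA.
have -> : A = (@trmx R 1 n) @` ((@trmx R 1 n) @^-1` A).
  apply/seteqP; split=> [x Ax|_ [x Ax <-]//].
  by exists x^T; rewrite /= trmxK.
apply: continuous_compact.
  by apply: continuous_subspaceT; exact: trmx_continuous.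
apply: bounded_closed_compact.
  exists M; split=> // x Mx y /= Ay.
  by rewrite -mx_norm_trmx; exact: AM Ay.
by apply: closed_comp cA => x _; exact: trmx_continuous.
Qed.

(** * Borel sets and tightness of a random vector *)

Lemma open_measurableV (R : realType) n (U : set 'cV[R]_n) :
  open U -> measurable (U : set (borelV R n)).
Proof. by move=> oU; exact: sub_sigma_algebra. Qed.

Lemma closed_measurableV (R : realType) n (C : set 'cV[R]_n) :
  closed C -> measurable (C : set (borelV R n)).
Proof.
move=> cC; rewrite -[C]setCK; apply: (@measurableC _ (borelV R n)).
by apply: open_measurableV; exact: closed_openC.
Qed.

Section random_vector.
Context d (Omega : measurableType d) (R : realType) (Pr : probability Omega R).
Context (n : nat) (X : Omega -> 'cV[R]_n).
Hypothesis mX : measurable_fun setT (X : Omega -> borelV R n).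

Lemma measurable_coord_comp i : measurable_fun setT (fun om => X om i 0).
Proof. exact: (measurableT_comp (measurable_coordV i) mX). Qed.

Lemma measurable_preimageV (B : set 'cV[R]_n) :
  measurable (B : set (borelV R n)) -> measurable (X @^-1` B).
Proof. by move=> mB; rewrite -[X in measurable X]setTI; exact: mX. Qed.

Lemma measurable_norm_gt r : measurable [set om | r < `|X om|].
Proof.
apply: (@measurable_preimageV [set x | r < `|x|]); apply: open_measurableV.
apply: (@open_comp _ _ (Num.norm : 'cV[R]_n -> R) [set x | r < x]) => [x _|].
  exact: norm_continuous.
exact: open_gt.
Qed.

(** Every value of [X] has finite norm, so the tail events decrease to the empty set, and continuity
    from above makes their probabilities tend to 0. *)
Lemma norm_tight (a : R) : 0 < a ->
  exists k : nat, (Pr [set om | (k%:R < `|X om|)%R] < a%:E)%E.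
Proof.
move=> a0; pose F (k : nat) := [set om | k%:R < `|X om|].
have F0 : \bigcap_k F k = set0.
  apply/seteqP; split=> // om /(_ (Num.truncn `|X om|).+1 I) /=.
  by rewrite /F/= ltNge ltW// truncnS_gt.
have mF k : measurable (F k) by exact: measurable_norm_gt.
have : (Pr \o F) x @[x --> \oo] --> Pr (\bigcap_k F k).
  apply: nonincreasing_cvg_mu => //.
  - by rewrite (le_lt_trans (probability_le1 _ (mF 0%N)))// ltry.
  - by rewrite F0.
  - move=> i j ij; apply/subsetPset => om; apply: le_lt_trans.
    by rewrite ler_nat.
rewrite F0 measure0 => /(_ [set x | (x < a%:E)%E])[].
  by apply: open_nbhs_nbhs; split; [exact: open_ereal_lt_ereal|rewrite /= lte_fin].
by move=> k _ /(_ k (leqnn k)) ?; exists k.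
Qed.

End random_vector.

(** * The probability that [y - X] falls in a fixed set, as a function of [y] *)

Section translated_set.
Context d (Omega : measurableType d) (R : realType) (Pr : probability Omega R).
Context (n : nat) (X : Omega -> 'cV[R]_n).
Hypothesis mX : measurable_fun setT (X : Omega -> borelV R n).

Lemma measurable_sub_preimage (B : set 'cV[R]_n) y :
  measurable (B : set (borelV R n)) -> measurable [set om | B (y - X om)].
Proof.
apply: (measurable_preimageV (X := fun om => y - X om)).
apply: measurable_coordsV => i.
under eq_fun do rewrite !mxE.
apply: measurable_funB => //; exact: measurable_coord_comp.
Qed.

Lemma bounded_prob_ge (O : set 'cV[R]_n) (a : R) : 0 < a ->
  measurable (O : set (borelV R n)) -> bounded_set O ->
  bounded_set [set y | (a%:E <= Pr [set om | O (y - X om)%R])%E].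
Proof.
move=> a0 mO [M [_ OM]].
have [k Xk] := norm_tight Pr mX a0.
(* [bounded_set] bounds [O] only by numbers strictly above [M], hence [M + 1]. If [y - X] has norm
   at most [M + 1] while [y] has norm above [M + 1 + k], then [X] has norm above [k], an event of
   probability below [a]. *)
exists (M + 1 + k%:R); split; first exact: num_real.
move=> r ltr y /= ay; apply: contraTT ay; rewrite -ltNge => ry.
rewrite -ltNge; apply: le_lt_trans Xk; apply: le_measure.
- by rewrite inE; exact: measurable_sub_preimage.
- by rewrite inE; exact: measurable_norm_gt.
- move=> om /= /(OM (M + 1) _) /= yX.
  have {}yX : `|y - X om| <= M + 1 by apply: yX; rewrite ltrDl.
  rewrite -(ltrD2l (M + 1)) (lt_le_trans ltr)// (le_trans (ltW ry))//.
  by rewrite -[in leLHS](subrK (X om) y) (le_trans (ler_normD _ _))// lerD2r.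
Qed.

Lemma upper_semicontinuous_prob (O : set 'cV[R]_n) : closed O ->
  upper_semicontinuous (fun y : 'cV[R]_n => Pr [set om | O (y - X om)]).
Proof.
move=> cO y a ya.
pose U (k : nat) := \bigcup_(o in O) ball o k.+1%:R^-1.
have oU k : open (U k) by apply: bigcup_open => o _; exact: ball_open.
have capU : \bigcap_k U k = O.
  apply/seteqP; split=> [z Uz|z Oz k _]; last by exists z => //; exact: ballxx.
  (* A point lying in every thickening has points of [O] arbitrarily near, so it belongs to the
     closure of [O]. *)
  apply: cO => V /nbhs_ballP[e /= e0 eV].
  have [k ke] : exists k : nat, k.+1%:R^-1 < e.
    have [k _ kP] := near_infty_natSinv_lt (PosNum e0).
    by exists k; exact: (kP k (leqnn k)).
  have [w Ow zw] := Uz k I; exists w; split=> //; apply: eV.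
  by apply: le_ball (ltW ke) _ _; exact: ball_sym.
pose F k := [set om | U k (y - X om)].
have mF k : measurable (F k).
  by apply: measurable_sub_preimage; exact: open_measurableV.
have FE : \bigcap_k F k = [set om | O (y - X om)].
  by rewrite -capU.
have : (Pr \o F) x @[x --> \oo] --> Pr (\bigcap_k F k).
  apply: nonincreasing_cvg_mu => //.
  - by rewrite (le_lt_trans (probability_le1 _ (mF 0%N)))// ltry.
  - exact: bigcap_measurableType.
  - move=> i j ij; apply/subsetPset => om [w Ow wy]; exists w => //.
    by apply: le_ball wy; rewrite lef_pV2 ?posrE// ler_nat.
rewrite FE => /(_ [set x | (x < a%:E)%E])[].
  by apply: open_nbhs_nbhs; split; [exact: open_ereal_lt_ereal|].
move=> k _ /(_ k (leqnn k)) /= Fk; exists (ball y k.+1%:R^-1).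
  by apply: nbhsx_ballx; rewrite invr_gt0.
move=> z yz; apply: le_lt_trans Fk; apply: le_measure.
- rewrite inE; apply: measurable_sub_preimage.
  exact: closed_measurableV.
- by rewrite inE.
(* The points [z - X om] and [y - X om] differ by [z - y] whatever [om] is, so the same [k] serves
   all outcomes. *)
- move=> om /= Oz; exists (z - X om) => //.
  by move: yz; rewrite -!ball_normE/= opprB addrA subrK distrC.
Qed.

End translated_set.

Lemma closed_superlevel (T : topologicalType) (R : realType) (f : T -> \bar R)
    (a : R) :
  upper_semicontinuous f -> closed [set y | (a%:E <= f y)%E].
Proof.
move=> uf; rewrite -openC openE => y /= /negP; rewrite -ltNge => ya.
have [V yV Va] := uf y a ya.
by apply: filterS yV => z /Va; rewrite /= ltNge => /negP.
Qed.

(** * Random elements with finitely many values *)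

Section discrete.
Context d (Omega : measurableType d).

(** This is measurability for the power set of [T], so [T] needs no sigma-algebra and singletons of
    parameters can be used as events. *)
Definition discrete_fun (T : Type) (f : Omega -> T) :=
  forall B : set T, measurable (f @^-1` B).

Lemma finite_range_discrete (T : Type) (f : Omega -> T) (D : set T) :
  finite_set D -> (forall om, D (f om)) ->
  (forall x, D x -> measurable (f @^-1` [set x])) -> discrete_fun f.
Proof.
move=> fD Df mf B.
have -> : f @^-1` B = \bigcup_(x in D `&` B) f @^-1` [set x].
  apply/seteqP; split=> [om Bf|om [x [_ Bx] /= ->]//].
  by exists (f om) => //; split.
apply: fin_bigcup_measurable => [|x [Dx _]]; last exact: mf.
exact: finite_setIl.
Qed.

(** Only finitely many pairs of values occur, so each preimage is a finite union of joint fibres of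
    [f] and [g], for an arbitrary [h]. *)
Lemma discrete_comp2 (T1 T2 T : Type) (f : Omega -> T1) (g : Omega -> T2)
    (h : T1 -> T2 -> T) (D : set T1) (E : set T2) :
  finite_set D -> finite_set E ->
  (forall om, D (f om)) -> (forall om, E (g om)) ->
  discrete_fun f -> discrete_fun g -> discrete_fun (fun om => h (f om) (g om)).
Proof.
move=> fD fE Df Eg df dg B.
have -> : (fun om => h (f om) (g om)) @^-1` B =
    \bigcup_(x in D) \bigcup_(y in E `&` [set y | B (h x y)])
      (f @^-1` [set x] `&` g @^-1` [set y]).
  apply/seteqP; split=> [om /= Bom|om [x _ [y [_ Bxy] [/= -> ->]]]//].
  by exists (f om) => //; exists (g om).
apply: fin_bigcup_measurable => // x _.
apply: fin_bigcup_measurable => [|y _]; first exact: finite_setIl.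
exact: measurableI.
Qed.

End discrete.

(** * Measurability of the continuous state *)

Lemma measurable_mulmx d (Omega : measurableType d) (R : realType) n m
    (M : 'M[R]_(n, m)) (X : Omega -> 'cV[R]_m) :
  measurable_fun setT (X : Omega -> borelV R m) ->
  measurable_fun setT (fun om => M *m X om : borelV R n).
Proof.
move=> mX; apply: measurable_coordsV => i; under eq_fun do rewrite mxE.
apply: measurable_sum => j; apply: measurable_funM => //.
exact: measurable_coord_comp.
Qed.

Section dmsp_measurability.
Context {d} {Omega : measurableType d} {R : realType} {Pr : probability Omega R}.
Context {N n m p l : nat} (S : dmsp Pr N n m p l).

Lemma mode_discrete t : (t <= N)%N -> discrete_fun (mode S t).
Proof.
move=> tN; apply: (finite_range_discrete (finite_modes S)).
  by move=> om; exact: mode_modes.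
move=> q _; rewrite -[X in measurable X]setTI.
by apply: (measurable_mode S tN).
Qed.

Lemma param_params t om : (t <= N)%N -> params S (param S t om).
Proof.
elim: t => [_|t IH tN]; first by rewrite param_init; exact: param0_params.
rewrite param_step//; apply: lfun_params => //; first exact: mode_modes.
by apply: IH; exact: ltnW.
Qed.

Lemma param_discrete t : (t <= N)%N -> discrete_fun (param S t).
Proof.
elim: t => [_ B|t IH tN].
  rewrite (_ : param S 0 = cst (param0 S)).
    by rewrite preimage_cst; case: ifP.
  by apply/funext => om; rewrite param_init.
rewrite (_ : param S t.+1 = fun om => lfun S (mode S t.+1 om) t (param S t om)).
  apply: (@discrete_comp2 _ _ _ _ _ _ _ (fun q lam => lfun S q t lam)
    (modes S) (params S)).
  - exact: finite_modes.
  - exact: finite_params.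
  - by move=> om; exact: mode_modes.
  - by move=> om; apply: param_params; exact: ltnW.
  - exact: mode_discrete.
  - by apply: IH; exact: ltnW.
by apply/funext => om; rewrite param_step.
Qed.

(** By induction on time: the events on which the parameter takes a given value are finitely many,
    measurable and cover [Omega], and on each of them the update is affine with constant
    matrices. *)
Lemma measurable_cstate t : (t <= N)%N ->
  measurable_fun setT (cstate S t : Omega -> borelV R n).
Proof.
elim: t => [_|t IH tN].
  rewrite (_ : cstate S 0 = cst (cstate0 S)); first exact: measurable_cst.
  by apply/funext => om; rewrite cstate_init.
(* The update with its parameter frozen at [lam]; it agrees with the true one where [param S t]
   equals [lam]. *)
pose next lam om := matA S lam *m cstate S t om + matB S lam *m input S t
  + matF S lam *m noise S t om.
have mnext lam : measurable_fun setT (next lam : Omega -> borelV R n).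
  apply: measurable_coordsV => i; under eq_fun do rewrite 2!mxE.
  apply: measurable_funD; [apply: measurable_funD => //|];
    apply: (@measurable_coord_comp _ _ _ _ (fun om => _ *m _));
    apply: measurable_mulmx; [apply: IH; exact: ltnW|exact: measurable_noise].
move=> _ B mB; rewrite setTI.
have -> : cstate S t.+1 @^-1` B = \bigcup_(lam in params S)
    (param S t @^-1` [set lam] `&` next lam @^-1` B).
  apply/seteqP; split=> [om /=|om [lam _ [/= <-]]]; rewrite cstate_step//.
  by exists (param S t om) => //; apply: param_params; exact: ltnW.
apply: fin_bigcup_measurable; first exact: finite_params.
move=> lam _; apply: measurableI; last exact: measurable_preimageV.
by apply: param_discrete; exact: ltnW.
Qed.

Lemma occupancyE hobs t y : (t <= N)%N ->
  occupancy S hobs t y = Pr [set om | obstacle hobs 0 (y - cstate S t om)].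
Proof.
move=> tN; congr (Pr _); rewrite /obstacle/opp_set/state/=.
apply/seteqP; split=> om /=.
  (* The reflected obstacle centred at [- y] evaluates [hobs] at [- x - (- y)], which is [y - x]. *)
  by move=> [q _ [_ /=]]; rewrite opprK subr0 addrC.
move=> h; exists (mode S t om); first exact: mode_modes.
by split=> //=; rewrite opprK addrC -[X in hobs X]subr0.
Qed.

End dmsp_measurability.

(** * Boundedness, closedness and compactness of the occupied set *)

Theorem proposition6 (R : realType) (d : measure_display)
    (Omega : measurableType d) (Pr : probability Omega R)
    (N n m p l : nat) (N_ge1 : (1 <= N)%N) (S : dmsp Pr N n m p l)
    (hobs : 'cV[R]_n -> R)
    (hobs_borel : measurable_fun setT (hobs : borelV R n -> R))
    (obstacle_borel : measurable (obstacle hobs 0 : set (borelV R n)))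
    (obstacle_nonzero : lebesgue_measureV n (obstacle hobs 0) != 0%E) :
  (bounded_set (obstacle hobs 0) ->
    forall (alpha : R) (tau : nat), 0 < alpha -> (1 <= tau <= N)%N ->
      bounded_set (PrOccupySet S hobs alpha tau)) /\
  (closed (obstacle hobs 0) ->
    forall tau : nat, (1 <= tau <= N)%N ->
      upper_semicontinuous (occupancy S hobs tau) /\
      forall alpha : R, 0 <= alpha ->
        closed (PrOccupySet S hobs alpha tau)) /\
  (compact (obstacle hobs 0) ->
    forall (alpha : R) (tau : nat), 0 < alpha -> (1 <= tau <= N)%N ->
      compact (PrOccupySet S hobs alpha tau)).
Proof.
have occE tau : (1 <= tau <= N)%N -> occupancy S hobs tau =
    fun y => Pr [set om | obstacle hobs 0 (y - cstate S tau om)].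
  by move=> /andP[_ tN]; apply/funext => y; exact: occupancyE.
have mX tau : (1 <= tau <= N)%N ->
    measurable_fun setT (cstate S tau : Omega -> borelV R n).
  by move=> /andP[_ tN]; exact: measurable_cstate.
have bounded_occ : bounded_set (obstacle hobs 0) ->
    forall (alpha : R) (tau : nat), 0 < alpha -> (1 <= tau <= N)%N ->
      bounded_set (PrOccupySet S hobs alpha tau).
  move=> bO alpha tau a0 tN; rewrite /PrOccupySet occE//.
  by apply: bounded_prob_ge => //; exact: mX.
have usc_occ : closed (obstacle hobs 0) -> forall tau, (1 <= tau <= N)%N ->
    upper_semicontinuous (occupancy S hobs tau).
  by move=> cO tau tN; rewrite occE//; apply: upper_semicontinuous_prob cO; exact: mX.
split=> //; split=> [cO tau tN|kO alpha tau a0 tN].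
  by split=> [|alpha _]; [exact: usc_occ|apply: closed_superlevel; exact: usc_occ].
(* A compact obstacle is bounded and closed, so the first two claims apply and Heine-Borel combines
   them. *)
apply: bounded_closed_compact_cV.
  by apply: bounded_occ => //; exact: compact_bounded.
by apply/closed_superlevel/usc_occ => //; apply: compact_closed.
Qed.
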